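(* Let $m\ge n\ge 1$. Given any $m\times m$ unitary operation $U$, one can map the initial state $|1_n\rangle$ to $\varphi(U)|1_n\rangle$ using a linear-optical network of depth $O(n\log m)$, consisting of $O(mn)$ beamsplitters and phaseshifters.
   Context: $\Phi_{m,n}$ is the set of tuples $S=(s_1,\dots,s_m)$ of nonnegative integers with sum $n$, and $H_{m,n}$ is the complex Hilbert space with orthonormal basis $\{|S\rangle:S\in\Phi_{m,n}\}$ ($n$ identical photons in $m$ modes, $s_i$ being the number of photons in mode $i$). The standard initial state is $|1_n\rangle=|1,\dots,1,0,\dots,0\rangle$ (one photon in each of the first $n$ modes, the remaining $m-n$ modes unoccupied). For an $m\times m$ unitary $W$, $\varphi(W)$ is the unitary on $H_{m,n}$ with $$\langle S|\varphi(W)|T\rangle=\frac{\mathrm{Per}(W_{S,T})}{\sqrt{s_1!\cdots s_m!\,t_1!\cdots t_m!}},$$ where $\mathrm{Per}$ is the permanent and $W_{S,T}$ is the $n\times n$ matrix obtained from $W$ by taking $t_j$ copies of the $j$-th column for each $j$, and then $s_i$ copies of the $i$-th row for each $i$. The map $\varphi$ is a group homomorphism. A phaseshifter is a diagonal unitary on the modes multiplying one mode by $e^{i\theta}$ and acting as the identity on the others; a beamsplitter is a unitary acting as $\begin{pmatrix}\cos\theta&-\sin\theta\\ \sin\theta&\cos\theta\end{pmatrix}$ on two chosen modes and as the identity on the others. A linear-optical network is a product $W=W_T\cdots W_1$ of beamsplitters and phaseshifters; it acts on $n$-photon states by $\varphi(W)$. Its depth is the minimum number of layers into which its elements can be grouped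 (respecting order) so that elements within a layer act on disjoint sets of modes. The $O(\cdot)$ bounds are asymptotic, with absolute constants. *)

(* Defs.v *)
From HB Require Import structures.
From mathcomp Require Import all_boot all_order all_fingroup all_algebra.
From mathcomp Require Import complex.
From mathcomp Require Import reals exp trigo.

Set Implicit Arguments.
Unset Strict Implicit.
Unset Printing Implicit Defensive.

Import Order.TTheory GRing.Theory Num.Theory.

Local Open Scope ring_scope.
Local Open Scope complex_scope.

Section Occupation.

Variables m n : nat.

(* The tuples (s_1, ..., s_m) of nonnegative integers with sum n.  Each s_i is
   at most n, so storing it in 'I_n.+1 loses nothing and makes the set a
   finType. *)
Definition has_total (S : {ffun 'I_m -> 'I_n.+1}) : bool :=
  (\sum_(i < m) (S i : nat))%N == n.

Definition Phi : finType := {S : {ffun 'I_m -> 'I_n.+1} | has_total S}.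

Definition occ (S : Phi) (i : 'I_m) : nat := val S i.

Definition one_fun : {ffun 'I_m -> 'I_n.+1} :=
  [ffun i : 'I_m => inord (i < n)%N].

Lemma one_fun_total (le_nm : (n <= m)%N) : has_total one_fun.
Proof.
rewrite /has_total (eq_bigr (fun i : 'I_m => (i < n)%N : nat)); last first.
  move=> i _; rewrite ffunE inordK //.
  by case: (ltnP i n) => // lt_in; rewrite [(_ < _)%N]ltnS; exact: leq_ltn_trans lt_in.
rewrite -(big_mkord xpredT (fun i => nat_of_bool (i < n)%N)).
rewrite (@big_cat_nat _ _ _ n) //= [X in (_ + X)%N]big_nat_cond.
rewrite [X in (_ + X)%N]big1 => [|i /andP[/andP[le_ni _] _]]; last first.
  by rewrite ltnNge le_ni.
rewrite addn0 big_nat_cond (eq_bigr (fun=> 1%N)); last first.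
  by move=> i /andP[/andP[_ ->] _].
by rewrite -big_nat_cond sum_nat_const_nat subn0 muln1.
Qed.

Definition one_occ (le_nm : (n <= m)%N) : Phi := exist _ one_fun (one_fun_total le_nm).

(* Mode i listed s_i times, in increasing order of i. *)
Definition mode_seq (S : Phi) : seq 'I_m :=
  flatten [seq nseq (occ S i) i | i <- enum 'I_m].

Lemma size_mode_seq (S : Phi) : size (mode_seq S) == n.
Proof.
rewrite size_flatten /shape -map_comp sumnE big_map big_enum /=.
rewrite (eq_bigr (fun i => val S i : nat)); first exact: (valP S).
by move=> i _; rewrite size_nseq.
Qed.

Definition modes (S : Phi) : n.-tuple 'I_m := Tuple (size_mode_seq S).

End Occupation.

Definition permanent (K : comPzRingType) (n : nat) (A : 'M[K]_n) : K :=
  \sum_(s : 'S_n) \prod_(i < n) A i (s i).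

Section Fock.

Variables (R : realType) (m n : nat).

(* H_{m,n} is the space of column vectors indexed by Phi m n, the latter being
   enumerated by enum_rank / enum_val. *)
Definition fock := 'cV[R[i]]_#|Phi m n|.

Definition ket (S : Phi m n) : fock := delta_mx (enum_rank S) 0.

Definition phi_entry (W : 'M[R[i]]_m) (S T : Phi m n) : R[i] :=
  permanent (mxsub (tnth (modes S)) (tnth (modes T)) W)
  / sqrtC ((\prod_(i < m) (occ S i)`!) * (\prod_(i < m) (occ T i)`!))%N%:R.

Definition phi (W : 'M[R[i]]_m) : 'M[R[i]]_#|Phi m n| :=
  \matrix_(a, b) phi_entry W (enum_val a) (enum_val b).

End Fock.

Section Networks.

Variables (R : realType) (m : nat).

Inductive element : Type :=
  | Phaseshifter of 'I_m & R
  | Beamsplitter (i j : 'I_m) of i != j & R.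

Definition element_modes (g : element) : {set 'I_m} :=
  match g with
  | Phaseshifter i _ => [set i]
  | @Beamsplitter i j _ _ => [set i; j]
  end.

Definition phaseshifter_mx (i : 'I_m) (theta : R) : 'M[R[i]]_m :=
  diag_mx (\row_k (if k == i then cos theta +i* sin theta else 1)).

Definition beamsplitter_mx (i j : 'I_m) (theta : R) : 'M[R[i]]_m :=
  \matrix_(k, l)
    if (k, l) \in [:: (i, i); (j, j)] then (cos theta)%:C
    else if (k, l) == (i, j) then - (sin theta)%:C
    else if (k, l) == (j, i) then (sin theta)%:C
    else (k == l)%:R.

Definition element_mx (g : element) : 'M[R[i]]_m :=
  match g with
  | Phaseshifter i theta => phaseshifter_mx i theta
  | @Beamsplitter i j _ theta => beamsplitter_mx i j theta
  end.

(* Listed in order of application: the head of the sequence acts first. *)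
Definition network := seq element.

Definition network_mx (N : network) : 'M[R[i]]_m :=
  foldl (fun W g => element_mx g *m W) 1%:M N.

(* Element a of N is put in layer l a.  Requiring the layers of two elements
   sharing a mode to be strictly ordered as in N says both that elements of the
   same layer act on disjoint sets of modes and that applying the layers one
   after the other only exchanges elements acting on disjoint sets of modes. *)
Definition is_layering (N : network) (d : nat)
    (l : {ffun 'I_(size N) -> 'I_d}) : bool :=
  [forall a : 'I_(size N), forall b : 'I_(size N),
    (a < b)%N &&
      ~~ [disjoint element_modes (tnth (in_tuple N) a)
                 & element_modes (tnth (in_tuple N) b)]
    ==> (l a < l b)%N].

Definition has_layering (N : network) : pred nat :=
  fun d => [exists l : {ffun 'I_(size N) -> 'I_d}, is_layering l].

Lemma has_layering_ex (N : network) : exists d, has_layering N d.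
Proof.
exists (size N); apply/existsP; exists [ffun a => a].
apply/forallP => a; apply/forallP => b; apply/implyP => /andP[lt_ab _].
by rewrite !ffunE.
Qed.

Definition depth (N : network) : nat := ex_minn (has_layering_ex N).

End Networks.

(* Main.v *)
Require Import Defs.
From mathcomp Require Import all_boot all_order all_fingroup all_algebra.
From mathcomp Require Import complex.
From mathcomp Require Import reals exp trigo.
From mathcomp Require Import ring lra zify.

Set Implicit Arguments.
Unset Strict Implicit.
Unset Printing Implicit Defensive.

Import Order.TTheory GRing.Theory Num.Theory.

Local Open Scope ring_scope.

(* The amplitudes of phi(W)|1_n> only involve the first n columns of W, so it
   suffices to find a network agreeing with U on these columns.  This is done by
   elimination, writing U = M_1 ... M_n A with A fixing the first n basis
   vectors: M_k rotates the k-th basis vector to the current k-th column.  Each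
   M_k is a binary tree.  Phaseshifters make all entries of the column
   nonnegative; then, the two halves of the modes having been treated in
   parallel, one beamsplitter merges the two remaining entries, which costs
   1 + log_2 m layers and fewer than 2m elements per column. *)

(** * Matrices of elements and networks *)

Section Polar.

Variable R : realType.

(** The angle is [acos (a / r)] with the sign of [b]. This serves twice: to split off the phase of a
    complex entry, and to find the rotation merging two real entries. *)
Lemma polar_coordinates (a b : R) :
  exists r theta, [/\ 0 <= r, a = r * cos theta & b = r * sin theta].
Proof.
pose r := Num.sqrt (a ^+ 2 + b ^+ 2).
have r2 : r ^+ 2 = a ^+ 2 + b ^+ 2 by rewrite sqr_sqrtr // addr_ge0 ?sqr_ge0.
have r_ge0 : 0 <= r by rewrite sqrtr_ge0.
have [r0|r_neq0] := eqVneq r 0.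
  exists 0, 0; rewrite !mul0r; split=> //; apply/eqP; rewrite -sqrf_eq0;
    move: r2; rewrite r0 expr0n /= => /esym/eqP;
    by rewrite paddr_eq0 ?sqr_ge0 // => /andP[].
have cos_bound : -1 <= a / r <= 1.
  rewrite -ler_norml -(@ler_pXn2r _ 2) ?nnegrE // expr1n real_normK ?num_real //.
  by rewrite expr_div_n ler_pdivrMr ?mul1r ?r2 ?lerDl ?sqr_ge0 // -r2 exprn_even_gt0.
have ar : a = r * (a / r) by rewrite mulrC divfK.
have sin_eq : Num.sqrt (1 - (a / r) ^+ 2) = `|b| / r.
  have -> : 1 - (a / r) ^+ 2 = (b / r) ^+ 2.
    apply: (@mulIf _ (r ^+ 2)); first by rewrite expf_neq0.
    by rewrite mulrBl !expr_div_n !divfK ?expf_neq0 // r2; ring.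
  by rewrite sqrtr_sqr normrM normfV (ger0_norm r_ge0).
have [b_ge0|b_lt0] := leP 0 b.
  exists r, (acos (a / r)); rewrite acosK ?in_itv //= sin_acos // sin_eq.
  by rewrite ger0_norm // !(mulrC r) !divfK.
exists r, (- acos (a / r)); rewrite cosN sinN acosK ?in_itv //= sin_acos // sin_eq.
by rewrite ltr0_norm // mulNr opprK !(mulrC r) !divfK.
Qed.

End Polar.

Section Elements.

Variables (R : realType) (m : nat).

Implicit Types (g : element R m) (N : network R m) (i j k : 'I_m).

Lemma mul_phaseshifter_mx i theta p (M : 'M[R[i]]_(m, p)) k l :
  (phaseshifter_mx i theta *m M) k l
    = (if k == i then (cos theta +i* sin theta)%C else 1) * M k l.
Proof. by rewrite mul_diag_mx !mxE. Qed.

Lemma mul_beamsplitter_mx i j theta p (M : 'M[R[i]]_(m, p)) k l : i != j ->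
  (beamsplitter_mx i j theta *m M) k l
    = if k == i then (cos theta)%:C%C * M i l - (sin theta)%:C%C * M j l
      else if k == j then (sin theta)%:C%C * M i l + (cos theta)%:C%C * M j l
      else M k l.
Proof.
move=> ij; rewrite mxE.
have [ki|ki] := eqVneq k i; last have [kj|kj] := eqVneq k j.
- subst k; rewrite (bigD1 i) //= (bigD1 j) /=; last by rewrite eq_sym.
  rewrite big1 ?addr0 => [|q /andP[qi qj]].
    by rewrite !mxE !inE !xpair_eqE !eqxx (eq_sym j) (negPf ij) /= mulNr.
  by rewrite !mxE !inE !xpair_eqE !eqxx /= (negPf ij) (negPf qi) (negPf qj) eq_sym
             (negPf qi) /= mul0r.
- subst k; rewrite (bigD1 i) //= (bigD1 j) /=; last by rewrite eq_sym.
  rewrite big1 ?addr0 => [|q /andP[qi qj]].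
    by rewrite !mxE !inE !xpair_eqE !eqxx (eq_sym j) (negPf ij) /=.
  by rewrite !mxE !inE !xpair_eqE !eqxx /= (eq_sym j) (negPf ij) (negPf qi) (negPf qj)
             eq_sym (negPf qj) /= mul0r.
- rewrite (bigD1 k) //= big1 ?addr0 => [|q qk].
    by rewrite !mxE !inE !xpair_eqE (negPf ki) (negPf kj) /= eqxx mul1r.
  by rewrite !mxE !inE !xpair_eqE (negPf ki) (negPf kj) /= eq_sym (negPf qk) mul0r.
Qed.

Lemma conjC_complex (x y : R) : ((x +i* y)%C : R[i])^* = (x -i* y)%C.
Proof. by []. Qed.

Lemma element_mx_unitary g : element_mx g \is unitarymx.
Proof.
apply/unitarymxP/matrixP; case: g => [i theta|i j ij theta] k l /=.
  rewrite mul_phaseshifter_mx !mxE.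
  have [->|kl] := eqVneq k l; last by rewrite !mulr0n conjC0 mulr0.
  rewrite !mulr1n; case: ifP => _; last by rewrite mul1r conjC1.
  rewrite conjC_complex; apply/eqP; rewrite eq_complex /=.
  by apply/andP; split; apply/eqP; [rewrite -(cos2Dsin2 theta)|]; ring.
have conjR (x : R) : (x%:C%C : R[i])^* = x%:C%C by rewrite conjC_complex oppr0.
have conjNR (x : R) : (- x%:C%C : R[i])^* = - x%:C%C by rewrite -rmorphN conjR.
have cs : (cos theta)%:C%C * (cos theta)%:C%C
          + (sin theta)%:C%C * (sin theta)%:C%C = 1 :> R[i].
  by rewrite -!rmorphM -rmorphD -!expr2 cos2Dsin2.
have eij := negPf ij; have eji : (j == i) = false by rewrite eq_sym.
rewrite mul_beamsplitter_mx // !mxE !inE !xpair_eqE !eqxx.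
case: (eqVneq k i) => [?|ki]; [|case: (eqVneq k j) => [?|kj]];
  (case: (eqVneq l i) => [?|li]; [|case: (eqVneq l j) => [?|lj]]); subst;
  rewrite ?eqxx ?eij ?eji /=.
- by rewrite conjNR !conjR mulrN opprK; exact: cs.
- by rewrite !conjR mulrC subrr.
- by rewrite !conjC0 !mulr0 subrr eq_sym (negPf li).
- by rewrite conjNR !conjR mulrN mulrC subrr.
- by rewrite !conjR addrC; exact: cs.
- by rewrite !conjC0 !mulr0 addr0 eq_sym (negPf lj).
- by rewrite eq_sym (negPf ki) conjC0.
- by rewrite eq_sym (negPf kj) conjC0.
- by rewrite eq_sym conjC_nat.
Qed.

Lemma network_mx_cons g N : network_mx (g :: N) = network_mx N *m element_mx g.
Proof.
rewrite /network_mx /= mulmx1; elim/last_ind: N => [|N h IH] /=.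
  by rewrite mul1mx.
by rewrite !foldl_rcons IH mulmxA.
Qed.

Lemma network_mx_cat N1 N2 : network_mx (N1 ++ N2) = network_mx N2 *m network_mx N1.
Proof.
elim: N1 => [|g N1 IH]; first by rewrite mulmx1.
by rewrite cat_cons !network_mx_cons IH mulmxA.
Qed.

Lemma network_mx_unitary N : network_mx N \is unitarymx.
Proof.
elim: N => [|g N IH]; first by apply/unitarymxP; rewrite trmx1 map_mx1 mulmx1.
by rewrite network_mx_cons mul_unitarymx ?element_mx_unitary.
Qed.

(** Rows and columns are both constrained, so [M] is block diagonal with an arbitrary block on [S],
    a property stable under products. *)
Definition trivial_off (S : {set 'I_m}) (M : 'M[R[i]]_m) : Prop :=
  forall i j, (i \notin S) || (j \notin S) -> M i j = (i == j)%:R.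

Lemma trivial_off1 S : trivial_off S 1%:M.
Proof. by move=> i j _; rewrite mxE. Qed.

Lemma trivial_offM S M1 M2 :
  trivial_off S M1 -> trivial_off S M2 -> trivial_off S (M1 *m M2).
Proof.
move=> t1 t2 i j /orP[iS|jS]; rewrite mxE.
  rewrite (bigD1 i) //= t1 ?iS // eqxx mul1r big1 ?addr0 ?t2 ?iS // => k ki.
  by rewrite t1 ?iS // eq_sym (negPf ki) mul0r.
rewrite (bigD1 j) //= t2 ?jS ?orbT // eqxx mulr1 big1 ?addr0 ?t1 ?jS ?orbT // => k kj.
by rewrite t2 ?jS ?orbT // (negPf kj) mulr0.
Qed.

Lemma trivial_off_sub (S S' : {set 'I_m}) M :
  S \subset S' -> trivial_off S M -> trivial_off S' M.
Proof.
move=> /subsetP sSS' tM i j ij; apply: tM; apply: contraLR ij.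
by rewrite !negb_or !negbK => /andP[/sSS' -> /sSS' ->].
Qed.

Lemma trivial_off_element g : trivial_off (element_modes g) (element_mx g).
Proof.
case: g => [i theta|i j ij theta] k l /=; rewrite !inE !mxE.
  have [<-|kl] := eqVneq k l; last by rewrite mulr0n.
  by rewrite orbb => /negPf ->.
rewrite !inE !xpair_eqE.
by do 4!case: eqVneq => //= ?.
Qed.

Lemma trivial_off_mul S M p (w : 'M[R[i]]_(m, p)) i l :
  trivial_off S M -> i \notin S -> (M *m w) i l = w i l.
Proof.
move=> tM iS; rewrite mxE (bigD1 i) //= tM ?iS // eqxx mul1r.
by rewrite big1 ?addr0 // => k ki; rewrite tM ?iS // eq_sym (negPf ki) mul0r.
Qed.

End Elements.

(** * Networks with explicit layers *)

Section Layers.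

Variables (R : realType) (m : nat).

Implicit Types (P : seq (element R m * nat)) (S : {set 'I_m}) (d : nat).

(* A pair (g, l) is the element g placed in layer l. *)
Definition compatible (p q : element R m * nat) : bool :=
  [disjoint element_modes p.1 & element_modes q.1] || (p.2 < q.2)%N.

(** Numeric labels carried by the elements turn composition into concatenation and shifting, which
    the finite functions of [is_layering] would make awkward. The set [S] allows subnetworks on
    disjoint modes to share layers. *)
Definition layered S d P : bool :=
  all (fun p => (element_modes p.1 \subset S) && (p.2 < d)%N) P
  && pairwise compatible P.

Definition delay d P : seq (element R m * nat) := [seq (p.1, (d + p.2)%N) | p <- P].

Definition labelled_mx P : 'M[R[i]]_m := network_mx (unzip1 P).

Lemma size_delay d P : size (delay d P) = size P.
Proof. exact: size_map. Qed.

Lemma labelled_mx_delay d P : labelled_mx (delay d P) = labelled_mx P.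
Proof. by rewrite /labelled_mx /unzip1 -map_comp. Qed.

Lemma labelled_mx_cat P1 P2 :
  labelled_mx (P1 ++ P2) = labelled_mx P2 *m labelled_mx P1.
Proof. by rewrite /labelled_mx /unzip1 map_cat network_mx_cat. Qed.

Lemma labelled_mx1 g d : labelled_mx [:: (g, d)] = element_mx g.
Proof. by rewrite /labelled_mx /= network_mx_cons /network_mx /= mul1mx. Qed.

Lemma labelled_mx_unitary P : labelled_mx P \is unitarymx.
Proof. exact: network_mx_unitary. Qed.

Lemma trivial_off_layered S d P : layered S d P -> trivial_off S (labelled_mx P).
Proof.
case/andP=> + _; elim: P => [|p P IH] /=; first by move=> _; apply: trivial_off1.
case/andP=> /andP[pS _] /IH tP.
rewrite /labelled_mx /= network_mx_cons; apply: trivial_offM tP _.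
by apply: trivial_off_sub pS _; exact: trivial_off_element.
Qed.

Lemma sub_layered S S' d d' P :
  S \subset S' -> (d <= d')%N -> layered S d P -> layered S' d' P.
Proof.
move=> sSS' dd' /andP[aP pP]; rewrite /layered pP andbT.
apply: sub_all aP => p /andP[pS pd].
by rewrite (subset_trans pS sSS') (leq_trans pd dd').
Qed.

Lemma all_allrel T (a b : pred T) (r : rel T) s1 s2 :
  (forall x y, a x -> b y -> r x y) -> all a s1 -> all b s2 -> allrel r s1 s2.
Proof. by move=> abr a1 b2; apply: sub_all a1 => x ax; apply: sub_all b2 => y /abr->. Qed.

(** Cross pairs are compatible whatever their labels, so [d] does not grow; the logarithmic depth of
    a tree rests on this. *)
Lemma layered_parallel S1 S2 d P1 P2 : [disjoint S1 & S2] ->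
  layered S1 d P1 -> layered S2 d P2 -> layered (S1 :|: S2) d (P1 ++ P2).
Proof.
move=> S12 l1 l2.
have /andP[a1 p1] := l1; have /andP[a2 p2] := l2.
have /andP[a1' _] := sub_layered (subsetUl S1 S2) (leqnn d) l1.
have /andP[a2' _] := sub_layered (subsetUr S1 S2) (leqnn d) l2.
rewrite /layered all_cat a1' a2' pairwise_cat p1 p2 !andbT /=.
apply: all_allrel a1 a2 => p q /andP[pS _] /andP[qS _].
by rewrite /compatible (disjointWl pS) // (disjointWr qS).
Qed.

Lemma layered_seq S d1 d2 P1 P2 :
  layered S d1 P1 -> layered S d2 P2 -> layered S (d1 + d2) (P1 ++ delay d1 P2).
Proof.
move=> l1 /andP[a2 p2]; have /andP[a1 p1] := l1.
have /andP[a1' _] := sub_layered (subxx S) (leq_addr d2 d1) l1.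
have a2' : all (fun p => (element_modes p.1 \subset S) && (d1 <= p.2 < d1 + d2)%N)
               (delay d1 P2).
  by rewrite all_map; apply: sub_all a2 => p /=; rewrite leq_addr ltn_add2l.
rewrite /layered all_cat a1' pairwise_cat p1 /=; apply/and3P; split.
- by apply: sub_all a2' => p /and3P[-> _ ->].
- by apply: all_allrel a1 a2' => p q /andP[_ pd] /and3P[_ dq _];
    rewrite /compatible (leq_trans pd dq) orbT.
- rewrite pairwise_map; apply: sub_pairwise p2 => p q.
  by rewrite /compatible /= ltn_add2l.
Qed.

Lemma depth_layered S d P : layered S d P -> (depth (unzip1 P) <= d)%N.
Proof.
case/andP=> aP pP; rewrite /depth; case: ex_minnP => k _; apply.
have in_P (a : 'I_(size (unzip1 P))) : (a < size P)%N.
  by case: a => a; rewrite size_map.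
have lab (a : 'I_(size (unzip1 P))) : (nth 0 (unzip2 P) a < d)%N.
  have /(all_nthP 0%N) : all (ltn^~ d) (unzip2 P).
    by rewrite all_map; apply: sub_all aP => p /andP[].
  by apply; rewrite (size_map snd) in_P.
apply/existsP; exists [ffun a => Ordinal (lab a)].
apply/forallP => a; apply/forallP => b; apply/implyP => /andP[ab].
rewrite !ffunE /=.
(* The index [a] shows that [P] is nonempty and so supplies a default element for [nth]. *)
pose p0 := tnth (in_tuple P) (Ordinal (in_P a)).
rewrite !(tnth_nth p0.1) /= !(nth_map p0) //.
by have /orP[->|] := elimT (pairwiseP p0) pP a b (in_P a) (in_P b) ab.
Qed.

End Layers.

(** * Reduction of a unitary to one fixing the first n basis vectors *)

Section Reduction.

Variables (R : realType) (m : nat).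

(** The network rebuilds [v] from the reduced vector [w], so no network has to be inverted. One
    layer of phaseshifters and at most [T] layers of merges suffice, with one phaseshifter per mode
    of [x :: s] and one beamsplitter per mode of [s]. *)
Lemma reduce_vector T (x : 'I_m) (s : seq 'I_m) (v : 'cV[R[i]]_m) :
  uniq (x :: s) -> (size (x :: s) <= 2 ^ T)%N ->
  exists P (w : 'cV[R[i]]_m),
    [/\ layered [set i in x :: s] T.+1 P, (size P <= (size s).*2.+1)%N,
        v = labelled_mx P *m w, 0 <= w x 0 & forall i, i \in s -> w i 0 = 0].
Proof.
elim: T => [|T IH] in x s v *.
  case: s => // _ _.
  have [r [theta [r_ge0 re im]]] :=
    polar_coordinates (complex.Re (v x 0)) (complex.Im (v x 0)).
  exists [:: (Phaseshifter x theta, 0%N)].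
  exists (\col_i if i == x then r%:C%C else v i 0); split=> //.
  - by rewrite /layered /= sub1set !inE eqxx.
  - apply/matrixP => i j; rewrite ord1 labelled_mx1 mul_phaseshifter_mx mxE.
    have [->|_] := eqVneq i x; last by rewrite mul1r.
    by apply/eqP; rewrite eq_complex /= re im; apply/andP; split; apply/eqP; ring.
  - by rewrite mxE eqxx lecE /= eqxx.
(* The predecessor leaves room for [x], which belongs to the first half. *)
move=> uxs sz; have := cat_take_drop (2 ^ T).-1 s.
have pow_gt0 : (0 < 2 ^ T)%N by rewrite expn_gt0.
have sz1 : (size (x :: take (2 ^ T).-1 s) <= 2 ^ T)%N.
  by rewrite /= size_take_min; move: pow_gt0; lia.
have sz2 : (size (drop (2 ^ T).-1 s) <= 2 ^ T)%N.
  by rewrite size_drop; move: sz; rewrite /= expnS; lia.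
move: sz1 sz2; set s1 := take _ s; case: (drop _ s) => [|y s2] sz1 sz2 def_s.
  rewrite cats0 in def_s; rewrite def_s in sz1.
  have [P [w [lP szP vP wx ws]]] := IH x s v uxs sz1.
  by exists P, w; split=> //; apply: sub_layered lP.
move: (uxs); rewrite -def_s -cat_cons cat_uniq => /and3P[u1 dis u2].
have [P1 [v1 [l1 szP1 eq1 v1x v1s]]] := IH x s1 v u1 sz1.
(* v2 is computed from v1 and not from v: the network P2 does not act on the
   modes x :: s1, so it leaves what P1 achieved there untouched. *)
have [P2 [v2 [l2 szP2 eq2 v2y v2s]]] := IH y s2 v1 u2 sz2.
have notin1 i : i \in x :: s1 -> i \notin y :: s2.
  by move=> i1; apply: contra dis => i2; apply/hasP; exists i.
have v12 i : i \in x :: s1 -> v2 i 0 = v1 i 0.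
  move=> /notin1 i2; rewrite eq2 (trivial_off_mul _ _ (trivial_off_layered l2)) //.
  by rewrite inE.
have xy : x != y.
  by apply: contraTneq (mem_head y s2) => exy; rewrite -{1}exy; apply/notin1/mem_head.
have v2x : 0 <= v2 x 0 by rewrite v12 ?mem_head.
have [r [theta [r_ge0 cx cy]]] :=
  polar_coordinates (complex.Re (v2 x 0)) (complex.Re (v2 y 0)).
(* The order on [R[i]] makes nonnegative entries real, so a real rotation can merge them. *)
have im0 (z : R[i]) : 0 <= z -> z = (complex.Re z)%:C%C.
  by case: z => a b; rewrite lecE /= => /andP[/eqP -> _].
pose w : 'cV[R[i]]_m :=
  \col_i (if i == x then r%:C%C else if i == y then 0 else v2 i 0).
have eq3 : v2 = beamsplitter_mx x y theta *m w.
  apply/matrixP => i j; rewrite ord1 mul_beamsplitter_mx // !mxE !eqxx.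
  rewrite [y == x]eq_sym (negPf xy).
  have [->|ix] := eqVneq i x; last have [->|iy] := eqVneq i y; last by [].
    by rewrite (im0 _ v2x) cx mulr0 subr0 -rmorphM mulrC.
  by rewrite (im0 _ v2y) cy mulr0 addr0 -rmorphM mulrC.
(* The elimination tree is run backwards: [v] is the product of the matrices of [P1], [P2] and the
   beamsplitter, applied to [w], so the beamsplitter acts first and the two halves follow one layer
   later. *)
exists ((Beamsplitter xy theta, 0%N) :: delay 1 (P2 ++ P1)), w; split.
- apply: (@layered_seq _ _ _ 1 T.+1 [:: (Beamsplitter xy theta, 0%N)]).
    rewrite /layered /= !andbT subUset !sub1set !inE eqxx !mem_cat.
    by rewrite !inE eqxx !orbT.
  have -> : [set i in (x :: s1) ++ y :: s2] = [set i in y :: s2] :|: [set i in x :: s1].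
    by rewrite setUC; apply/setP => i; rewrite !inE mem_cat inE orbA.
  apply: layered_parallel => //.
  by rewrite disjoint_sym disjoint_subset; apply/subsetP => i;
    rewrite !inE => /notin1; rewrite inE.
- by rewrite /= size_delay !size_cat /=; clear -szP1 szP2; lia.
- by rewrite -cat1s labelled_mx_cat labelled_mx_delay labelled_mx_cat labelled_mx1
             -!mulmxA -eq3 -eq2.
- by rewrite mxE eqxx lecE /= eqxx.
- move=> i i12; rewrite mxE; case: eqP => [ix|_].
    by move: uxs; rewrite /= -def_s -ix i12.
  case: eqP => // /eqP iy.
  move: i12; rewrite mem_cat inE (negPf iy) /= => /orP[i1|/v2s //].
  by rewrite v12 ?inE ?i1 ?orbT // v1s.
Qed.

End Reduction.

Section Columns.

Variables (R : realType) (m : nat).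

(** [unitarymx] speaks of rows; columns are reached because a right inverse of a square matrix is
    also a left inverse. *)
Lemma unitary_col_dot (A : 'M[R[i]]_m) i j :
  A \is unitarymx -> \sum_k (A k i)^* * A k j = (i == j)%:R.
Proof.
move=> /unitarymxP/mulmx1C/matrixP/(_ i j); rewrite !mxE => <-.
by apply: eq_bigr => k _; rewrite !mxE.
Qed.

Definition fixes_below k (A : 'M[R[i]]_m) : Prop :=
  forall i j : 'I_m, (j < k)%N -> A i j = (i == j)%:R.

(** The tree is built on the modes from [k] on, so it fixes the earlier basis vectors and preserves
    the columns already cleared. Unitarity then determines the rest of column [k]. *)
Lemma clear_column T (k : 'I_m) (A : 'M[R[i]]_m) : (m <= 2 ^ T)%N ->
  A \is unitarymx -> fixes_below k A ->
  exists P (A' : 'M[R[i]]_m),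
    [/\ layered setT T.+1 P, (size P <= m.*2)%N,
        A = labelled_mx P *m A', A' \is unitarymx & fixes_below k.+1 A'].
Proof.
move=> mT uA fA.
pose s := [seq i : 'I_m <- enum 'I_m | (k < i)%N].
have ks : k \notin s by rewrite mem_filter ltnn.
have us : uniq (k :: s) by rewrite /= ks filter_uniq ?enum_uniq.
have szs : (size (k :: s) <= m)%N.
  by rewrite -[leqRHS]size_enum_ord uniq_leq_size // => i _; rewrite mem_enum.
have [P [w [lP szP colA wk ws]]] := reduce_vector (col k A) us (leq_trans szs mT).
have tP := trivial_off_layered lP.
set M := labelled_mx P in colA tP.
have uM : M \is unitarymx := labelled_mx_unitary P.
have unitM := unitarymx_unit uM.
have out (i : 'I_m) : (i < k)%N -> i \notin [set i in k :: s].
  move=> ik; rewrite !inE mem_filter negb_or negb_and -leqNgt (ltnW ik) /=.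
  by rewrite andbT neq_ltn ik.
pose A' := invmx M *m A.
have defA : A = M *m A' by rewrite mulKVmx.
have uA' : A' \is unitarymx.
  by apply: mul_unitarymx uA; rewrite (invmx_unitary uM) trmxC_unitary.
have fA' : fixes_below k A'.
  move=> i j jk; have /matrixP/(_ i 0) : col j A' = delta_mx j 0.
    have Mj : M *m delta_mx j 0 = delta_mx j 0 :> 'cV[R[i]]_m.
      rewrite -colE; apply/matrixP => l q.
      by rewrite ord1 !mxE tP ?(out _ jk) ?orbT // eqxx andbT.
    rewrite -[RHS](mulKmx unitM) Mj /A' colE -mulmxA -colE; congr (_ *m _).
    by apply/matrixP => l q; rewrite ord1 !mxE fA // eqxx andbT.
  by rewrite !mxE eqxx andbT.
have colA' : col k A' = w.
  by rewrite /A' !colE -mulmxA -[A *m _]colE colA mulKmx.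
have A'k i : A' i k = w i 0 by rewrite -colA' [RHS]mxE.
(* Rows above k vanish by orthogonality to the earlier columns. *)
have w0 i : i != k -> w i 0 = 0.
  move=> ik; case: (ltnP k i) => [ki|]; first by rewrite ws // mem_filter ki mem_enum.
  rewrite leq_eqVlt val_eqE (negPf ik) /= => i_lt_k.
  have := unitary_col_dot i k uA'; rewrite (negPf ik) (bigD1 i) //= big1 ?addr0.
    by rewrite fA' // eqxx conjC1 mul1r A'k.
  by move=> l li; rewrite fA' // (negPf li) conjC0 mul0r.
(* Column [k] has norm 1 and a single nonzero entry; the nonnegativity given by [reduce_vector]
   excludes the value -1. *)
have w1 : w k 0 = 1.
  have := unitary_col_dot k k uA'; rewrite eqxx (bigD1 k) //= big1 ?addr0.
    rewrite A'k mulrC -normCK ger0_norm // => /eqP.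
    by rewrite sqrf_eq1 => /orP[/eqP //|/eqP w1]; move: wk; rewrite w1 ler0N1.
  by move=> l lk; rewrite A'k w0 // conjC0 mul0r.
exists P, A'; split=> //.
- exact: sub_layered (subsetT _) (leqnn _) lP.
- by apply: leq_trans szP _; move: szs; clear=> /=; lia.
- move=> i j; rewrite ltnS leq_eqVlt => /orP[|/fA' //]; rewrite val_eqE => /eqP ->.
  by rewrite A'k; have [->|/w0] := eqVneq i k.
Qed.

Lemma clear_columns T k (A : 'M[R[i]]_m) : (m <= 2 ^ T)%N -> (k <= m)%N ->
  A \is unitarymx ->
  exists P (A' : 'M[R[i]]_m),
    [/\ layered setT (k * T.+1) P, (size P <= k * m.*2)%N,
        A = labelled_mx P *m A', A' \is unitarymx & fixes_below k A'].
Proof.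
move=> mT km uA; elim: k km => [|k IH] km.
  by exists [::], A; split=> //; rewrite /labelled_mx /network_mx /= mul1mx.
have [P [A1 [lP szP defA uA1 fA1]]] := IH (ltnW km).
have [Q [A2 [lQ szQ defA1 uA2 fA2]]] := @clear_column T (Ordinal km) A1 mT uA1 fA1.
(* The factor of [Q] stands to the right of that of [P], so the network of the newest column acts
   first. *)
exists (Q ++ delay T.+1 P), A2; split=> //.
- by rewrite mulSn; apply: layered_seq.
- by rewrite size_cat size_delay mulSn leq_add.
- by rewrite labelled_mx_cat labelled_mx_delay -mulmxA -defA1.
Qed.

End Columns.

(** * The initial state and the depth bound *)

Section InitialState.

Variables (R : realType) (m n : nat).

Lemma mem_modes (S : Phi m n) i : (i \in modes S) = (0 < occ S i)%N.
Proof.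
apply/flattenP/idP => [[s /mapP[j _ ->]]|i_gt0].
  by rewrite mem_nseq => /andP[? /eqP ->].
by exists (nseq (occ S i) i); [apply: map_f; rewrite mem_enum | rewrite mem_nseq i_gt0 /=].
Qed.

(** Only occupied modes are listed. Hence the permanents giving the amplitudes of the image of the
    initial state use columns of index below [n] alone. *)
Lemma tnth_modes_one_lt (le_nm : (n <= m)%N) j : (tnth (modes (one_occ le_nm)) j < n)%N.
Proof.
have := mem_tnth j (modes (one_occ le_nm)); rewrite mem_modes /occ /= ffunE.
by apply: contraTT => /negPf ->; rewrite inordK.
Qed.

Lemma eq_phi_ket_one (le_nm : (n <= m)%N) (W U : 'M[R[i]]_m) :
  (forall i j : 'I_m, (j < n)%N -> W i j = U i j) ->
  phi n W *m ket R (one_occ le_nm) = phi n U *m ket R (one_occ le_nm).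
Proof.
move=> eqWU; rewrite /ket -!colE; apply/matrixP => a b.
rewrite !mxE enum_rankK; congr (_ / _).
apply: eq_bigr => s _; apply: eq_bigr => i _.
by rewrite !mxE eqWU // tnth_modes_one_lt.
Qed.

End InitialState.

(** Minimality of [up_log] bounds its predecessor by the binary logarithm of [m]. The remaining 2 is
    at most twice that logarithm since [m] is at least 2, whence the factor 3. *)
Lemma up_log2_le_ln (R : realType) (m : nat) : (1 < m)%N ->
  (up_log 2 m).+1%:R <= 3 / ln 2 * ln m%:R :> R.
Proof.
move=> m_gt1; have ln2 : 0 < ln 2 :> R by rewrite ln_gt0 ?ltr1n.
have m_gt0 : (0 : R) < m%:R by rewrite ltr0n ltnW.
have le_ln2 : ln 2 <= ln m%:R :> R by rewrite ler_ln ?posrE // ler_nat.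
have le_ln : ((up_log 2 m).-1)%:R * ln 2 <= ln m%:R :> R.
  rewrite mulr_natl -lnXn // -natrX ler_ln ?posrE ?ltr0n ?expn_gt0 ?(ltnW m_gt1) // ler_nat.
  by rewrite ltnW // up_log_gtn.
have up_gt0 : (0 < up_log 2 m)%N by rewrite up_log_gt0.
rewrite -[up_log 2 m in leLHS](prednK up_gt0) mulrAC ler_pdivlMr //.
by rewrite -addn2 natrD mulrDl; lra.
Qed.

Theorem theorem45 (R : realType) :
  exists C : R, forall (m n : nat) (le_nm : (n <= m)%N), (1 <= n)%N ->
    forall U : 'M[R[i]]_m, U \is unitarymx ->
      exists N : network R m,
        [/\ phi n (network_mx N) *m ket R (one_occ le_nm)
              = phi n U *m ket R (one_occ le_nm),
            (1 < m)%N -> (depth N)%:R <= C * (n%:R * ln m%:R)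
          & (size N)%:R <= C * (m * n)%:R].
Proof.
have ln2 : 0 < ln 2 :> R by rewrite ln_gt0 ?ltr1n.
(* The summand 2 accounts for the size, at most [n * m.*2], and [3 / ln 2] for the depth. *)
exists (2 + 3 / ln 2) => m n le_nm n_gt0 U uU.
have [P [A [lP szP defU uA fA]]] := clear_columns (@up_logP 2 m isT) le_nm uU.
exists (unzip1 P); split.
- apply: eq_phi_ket_one => i j jn; rewrite defU -/(labelled_mx P) [RHS]mxE (bigD1 j) //=.
  rewrite fA // eqxx mulr1 big1 ?addr0 // => k kj.
  by rewrite fA // (negPf kj) mulr0.
(* For [m] equal to 1 the logarithm vanishes, although a phaseshifter may still be required. *)
- move=> m_gt1; have := depth_layered lP; rewrite -(ler_nat R) => /le_trans -> //.
  have := up_log2_le_ln R m_gt1; set u := _.+1%:R; set v := 3 / _ => uv.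
  have ln_ge0 : 0 <= ln m%:R :> R by rewrite ltW // ln_gt0 // ltr1n.
  rewrite natrM -/u mulrCA ler_wpM2l ?ler0n // mulrDl (le_trans uv) // lerDr.
  by rewrite mulr_ge0.
- rewrite size_map; apply: le_trans (_ : 2 * (m * n)%:R <= _).
    rewrite -natrM ler_nat (leq_trans szP) //; lia.
  by rewrite ler_wpM2r ?ler0n // lerDl divr_ge0 // ltW.
Qed.
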